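(* There is a randomized algorithm that reconstructs any connected chordal graph $G$ of maximum degree $\Delta$ using a distance oracle, with expected query complexity $$O\big(\Delta^3 2^\Delta\cdot n(2^\Delta+\log^2 n)\log n\big),$$ which is $\tilde O(n)$ when $\Delta=O(\log\log n)$.
   Context: Let $G=(V,E)$ be an unknown connected, unweighted, undirected simple graph with $|V|=n$, and let $\delta$ be its shortest-path metric. A distance oracle receives $(u,v)\in V^2$ and returns $\delta(u,v)$. In the reconstruction problem, the algorithm is given $V$ (and the degree bound $\Delta$), has access to the oracle, and must output $E$. A graph is chordal if every cycle of length greater than three has a chord (an edge joining two nonconsecutive vertices of the cycle). *)

(* Defs.v *)
From HB Require Import structures.
From mathcomp Require Import all_boot all_order all_algebra.
Set Implicit Arguments. Unset Strict Implicit. Unset Printing Implicit Defensive.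
Import Order.TTheory GRing.Theory Num.Theory.

Section Graphs.
Variable n : nat.
Implicit Types (e : rel 'I_n).

Definition simple_graph e := symmetric e /\ irreflexive e.

Definition connected e := forall u v : 'I_n, connect e u v.

Definition max_degree_le e (D : nat) := forall v : 'I_n, #|[set w | e v w]| <= D.

Definition has_chord e (c : seq 'I_n) :=
  exists x y, [/\ x \in c, y \in c, e x y, next c x != y & next c y != x].

Definition chordal e :=
  forall c : seq 'I_n, uniq c -> 3 < size c -> cycle e c -> has_chord e c.

Fixpoint ball e (k : nat) (u : 'I_n) : {set 'I_n} :=
  match k with
  | 0 => [set u]
  | k'.+1 => ball e k' u :|: [set y | [exists x in ball e k' u, e x y]]
  end.

(* shortest-path distance: least k (< n) such that v is within distance k of u
   (for connected graphs this is the shortest-path metric delta) *)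
Definition dist e (u v : 'I_n) : nat := find (fun k => v \in ball e k u) (iota 0 n).

Definition edge_set e : {set 'I_n * 'I_n} := [set p | e p.1 p.2].

(* A (possibly non-terminating) randomized algorithm with access to a distance
   oracle: it may output an edge set, query the oracle on (u,v) and continue
   depending on the answer, or flip a fair coin. *)
CoInductive qalg : Type :=
  | Out of {set 'I_n * 'I_n}
  | Ask of 'I_n & 'I_n & (nat -> qalg)
  | Flip of qalg & qalg.

Local Open Scope ring_scope.

(* expected number of oracle queries made during the first k steps of the run
   against oracle delta; the expected query complexity is the supremum over k *)
Fixpoint ecost (delta : 'I_n -> 'I_n -> nat) (k : nat) (t : qalg) : rat :=
  match k with
  | 0%N => 0
  | k'.+1 =>
    match t with
    | Out _ => 0
    | Ask u v f => 1 + ecost delta k' (f (delta u v))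
    | Flip a b => (ecost delta k' a + ecost delta k' b) / 2%:R
    end
  end.

Fixpoint pout (delta : 'I_n -> 'I_n -> nat) (E : {set 'I_n * 'I_n}) (k : nat)
    (t : qalg) : rat :=
  match k with
  | 0%N => 0
  | k'.+1 =>
    match t with
    | Out E' => if E' == E then 1 else 0
    | Ask u v f => pout delta E k' (f (delta u v))
    | Flip a b => (pout delta E k' a + pout delta E k' b) / 2%:R
    end
  end.

Definition outputs_as (delta : 'I_n -> 'I_n -> nat) (E : {set 'I_n * 'I_n})
    (t : qalg) :=
  forall eps : rat, 0 < eps -> exists k, 1 - eps <= pout delta E k t.

Definition expected_queries_le (delta : 'I_n -> 'I_n -> nat) (t : qalg) (B : rat) :=
  forall k, ecost delta k t <= B.

End Graphs.

Arguments Out {n}.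
Arguments Ask {n}.
Arguments Flip {n}.

Definition log2c (n : nat) : nat := up_log 2 n.

(* Main.v *)
Require Import Defs.
From HB Require Import structures.
From mathcomp Require Import all_boot all_order all_algebra.
From Stdlib Require Import Classical_Prop.
Set Implicit Arguments. Unset Strict Implicit. Unset Printing Implicit Defensive.
Import Order.TTheory GRing.Theory Num.Theory.

(** A deterministic strategy suffices; it asks O(D^3 n log n) queries.

    Query a root r against every vertex to get the BFS layers, then insert the
    vertices one by one in order of layer. In a chordal graph, two vertices of
    layer i attached to the same connected piece of the layers above i are
    adjacent: otherwise a shortest path between them through that piece and one
    through the layers below close up to a chordless cycle. Three consequences:
    - the parents of a vertex v of layer i+1 form a clique, and every known
      neighbour of v is within distance 2 of any parent;
    - a shortest walk from v to a known vertex can be rerouted through a parent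
      of v and then inside the known layers 0, ..., i;
    - a component C of the layers >= j meets layer j in at most (D+1)^2 vertices,
      and these separate the rest of C from the rest of the graph, which yields
      balanced separators S of that size.
    To insert v, let W be the set of possible parents. Query v against a balanced
    separator S for W and against the neighbours of S: either a parent shows up, or
    the nearest queried vertex lies in the component of G - S that contains all
    parents, and W is halved. After about log n rounds a parent s is known, and the
    remaining neighbours of v are found by querying the ball of radius 2 around s. *)

(** * Balls and shortest-path distance *)

Section Distance.
Variables (n : nat) (e : rel 'I_n).
Implicit Types (u v x y : 'I_n) (k m : nat).

Lemma in_ballS k u y :
  (y \in ball e k.+1 u) =
  (y \in ball e k u) || [exists x in ball e k u, e x y].
Proof. by rewrite /= inE [y \in [set _ | _]]inE. Qed.

Lemma ball_step k u x y : x \in ball e k u -> e x y -> y \in ball e k.+1 u.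
Proof.
by move=> xk exy; rewrite in_ballS; apply/orP; right; apply/existsP; exists x; rewrite xk.
Qed.

Lemma ball_le k m u : k <= m -> ball e k u \subset ball e m u.
Proof.
move=> /subnK <-; elim: (m - k) => // d /subset_trans; apply.
by apply/subsetP => y yd; rewrite addSn in_ballS yd.
Qed.

Lemma ball_trans k m u x y :
  x \in ball e k u -> y \in ball e m x -> y \in ball e (k + m) u.
Proof.
move=> xk; elim: m y => [|m IH] y; first by rewrite addn0 inE => /eqP->.
rewrite in_ballS addnS => /orP[/IH|/existsP[z /andP[/IH zk ezy]]].
  by apply/subsetP/ball_le.
exact: ball_step zk ezy.
Qed.

Lemma ball_sym k u x : symmetric e -> (x \in ball e k u) = (u \in ball e k x).
Proof.
move=> esym; suff imp v y : y \in ball e k v -> v \in ball e k y.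
  by apply/idP/idP; apply: imp.
elim: k y => [|k IH] y; first by rewrite !inE eq_sym.
rewrite in_ballS => /orP[/IH|/existsP[z /andP[/IH vk ezy]]].
  by apply/subsetP/ball_le.
rewrite -add1n; apply: ball_trans vk.
by apply: (@ball_step 0 _ y); rewrite ?inE // esym.
Qed.

Lemma path_ball u p : path e u p -> last u p \in ball e (size p) u.
Proof.
elim/last_ind: p => [|p x IH]; first by rewrite inE.
rewrite rcons_path last_rcons size_rcons => /andP[/IH]; exact: ball_step.
Qed.

Lemma card_ball1 D u : max_degree_le e D -> #|ball e 1 u| <= D.+1.
Proof.
move=> degD; apply: (@leq_trans #|u |: [set w | e u w]|).
  apply/subset_leq_card/subsetP => y; rewrite in_ballS !inE.
  case/orP=> [->//|/existsP[x]]; rewrite inE => /andP[/eqP-> ->].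
  by rewrite orbT.
by rewrite cardsU1 -add1n leq_add // leq_b1.
Qed.

Lemma card_bigcup_ball1 D (X : {set 'I_n}) : max_degree_le e D ->
  #|\bigcup_(x in X) ball e 1 x| <= #|X| * D.+1.
Proof.
move=> degD; apply: (@leq_trans (\sum_(x in X) #|ball e 1 x|)).
  apply: (big_ind2 (fun (A : {set 'I_n}) a => #|A| <= a)) => [|A a B b lea leb|//].
    by rewrite cards0.
  exact: leq_trans (leq_card_setU _ _) (leq_add lea leb).
by rewrite -sum_nat_const; apply: leq_sum => x _; apply: card_ball1.
Qed.

Lemma card_ball2 D u : max_degree_le e D -> #|ball e 2 u| <= D.+1 * D.+1.
Proof.
move=> degD; apply: (@leq_trans #|\bigcup_(x in ball e 1 u) ball e 1 x|).
  apply/subset_leq_card/subsetP => y; rewrite in_ballS.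
  case/orP=> [y1|/existsP[x /andP[x1 exy]]]; apply/bigcupP.
    by exists y => //; rewrite in_ballS inE eqxx.
  by exists x => //; apply: ball_step exy; rewrite inE.
by apply: leq_trans (card_bigcup_ball1 _ degD) _; rewrite leq_mul2r card_ball1 ?orbT.
Qed.

Hypothesis econ : connected e.

(** A path without repetition has fewer than n edges, so the search over [iota 0 n] succeeds and
    never returns its default n; monotonicity of the balls does the rest. *)
Lemma dist_le k u v : (dist e u v <= k) = (v \in ball e k u).
Proof.
have [m lt_mn vm] : exists2 m, m < n & v \in ball e m u.
  have /connectP[p up lvp] := econ u v.
  case/shortenP: up lvp => p' up' uniq_p' _ ->.
  exists (size p'); last exact: path_ball.
  by have /card_uniqP /= <- := uniq_p'; rewrite -[leqRHS]card_ord max_card.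
pose a k := v \in ball e k u.
have hasa : has a (iota 0 n).
  by apply/hasP; exists m => //; rewrite mem_iota.
have ltd : dist e u v < n by rewrite -[leqRHS](size_iota 0) -has_find.
have va : v \in ball e (dist e u v) u.
  by have := nth_find 0 hasa; rewrite /a -/(dist e u v) nth_iota.
apply/idP/idP => [/(ball_le u)/subsetP|vk]; first by apply.
rewrite leqNgt; apply/negP => ltk.
have := before_find 0 ltk; rewrite nth_iota ?add0n ?vk //.
exact: ltn_trans ltd.
Qed.

Lemma dist_eq0 u v : (dist e u v == 0) = (v == u).
Proof. by rewrite -leqn0 dist_le inE. Qed.

Lemma dist_step u x y : e x y -> dist e u y <= (dist e u x).+1.
Proof. by move=> exy; rewrite dist_le (ball_step _ exy) // -dist_le. Qed.

Lemma dist_parent u y m : dist e u y = m.+1 -> exists2 x, e x y & dist e u x = m.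
Proof.
move=> dy; have: y \in ball e m.+1 u by rewrite -dist_le dy.
rewrite in_ballS -dist_le dy ltnn => /existsP[x /andP[xm exy]].
exists x => //; apply/eqP; rewrite eqn_leq dist_le xm -ltnS -dy.
exact: dist_step.
Qed.

Lemma dist_eq1 u v : irreflexive e -> (dist e u v == 1) = e u v.
Proof.
move=> eirr; rewrite eqn_leq dist_le lt0n dist_eq0 in_ballS inE.
case: eqVneq => [->|ne]; first by rewrite eirr.
rewrite andbT /=; apply/existsP/idP => [[x]|euv].
  by rewrite inE => /andP[/eqP->].
by exists u; rewrite inE eqxx.
Qed.

Lemma dist_leq_size u v : dist e u v <= n.
Proof. by rewrite -[leqRHS](size_iota 0) find_size. Qed.

End Distance.

(** * Cycles, induced subgraphs and chordless paths *)

Lemma next_catE (T : eqType) (x y : T) s1 s2 :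
  uniq (s1 ++ x :: y :: s2) -> next (s1 ++ x :: y :: s2) x = y.
Proof.
move=> us; rewrite -(next_rot (size s1) us) rot_size_cat /=.
by rewrite eqxx.
Qed.

Section Induced.
Variables (T : finType) (h : rel T).

Definition induced (X : {set T}) : rel T := [rel x y | [&& x \in X, y \in X & h x y]].

Lemma induced_sym X : symmetric h -> symmetric (induced X).
Proof. by move=> hs x y; rewrite /induced /= hs andbCA. Qed.

Lemma induced_sub X : subrel (induced X) h.
Proof. by move=> x y /and3P[]. Qed.

Lemma path_induced X x p : path (induced X) x p -> p != [::] -> {subset x :: p <= X}.
Proof.
elim: p x => // y p IH x /= /andP[/and3P[xX yX _] py] _ z; rewrite inE.
case/predU1P=> [->//|]; case: p IH py => [|z' p] IH py; first by rewrite inE => /eqP->.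
exact: IH.
Qed.

(* [p] is a shortest path; the conclusion negates [has_chord] for chords joining
   two of its vertices. *)
Lemma chordless_path a b : symmetric h -> connect h a b -> a != b ->
  exists p, [/\ path h a (rcons p b), uniq (a :: rcons p b) &
    forall x y q, x \in a :: rcons p b -> y \in a :: rcons p b -> h x y -> x != y ->
      uniq (a :: rcons p b ++ q) ->
      next (a :: rcons p b ++ q) x = y \/ next (a :: rcons p b ++ q) y = x].
Proof.
move=> hsym hab neab.
pose W m := [exists t : m.-tuple T, path h a t && (last a t == b)].
have exW : exists m, W m.
  have /connectP[p hp lb] := hab; exists (size p); apply/existsP.
  by exists (in_tuple p); rewrite hp /= lb eqxx.
case: (ex_minnP exW) => m /existsP[t /andP[ht /eqP lt]] minm.
have min s : path h a s -> last a s = b -> size t <= size s.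
  move=> hs ls; rewrite size_tuple; apply: minm; apply/existsP.
  by exists (in_tuple s); rewrite hs ls /=.
case: (lastP t) ht lt min => [|p b'] hp; first by move=> /= /eqP; rewrite (negPf neab).
rewrite last_rcons => eb min; rewrite {b'}eb in hp min.
exists p; split=> //.
  case/shortenP: (hp) min (last_rcons a p b) => s hs us sub min ls.
  apply: (leq_size_uniq us); last by rewrite ltnS min.
  by move=> z; rewrite !inE => /predU1P[->|/sub->]; rewrite ?eqxx ?orbT.
(* An edge from x to a later y is a step of the path: otherwise s2 is nonempty, and cutting it out
   gives a shorter walk. The suffix q stands for the second half of the cycle closed in
   [layer_clique]. *)
have consec x y s1 s2 s3 q : a :: rcons p b = s1 ++ x :: s2 ++ y :: s3 -> h x y ->
    uniq (a :: rcons p b ++ q) -> next (a :: rcons p b ++ q) x = y.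
  rewrite -(cat_cons a) => eP hxy; case: s2 eP => [|z s2] eP.
    by rewrite eP -!catA; apply: next_catE.
  have: sorted h (s1 ++ x :: y :: s3).
    have: sorted h (a :: rcons p b) by [].
    by rewrite eP sorted_cat_cons sorted_cat_cons cat_path /= hxy => /and3P[-> _ /andP[_]].
  have lastb: last a (s1 ++ x :: y :: s3) = b.
    by have := congr1 (last a) eP; rewrite /= last_rcons !last_cat /= last_cat.
  have szp : size (rcons p b) = (size s1 + (size s2 + size s3).+2)%N.
    by have := congr1 size eP; rewrite /= !size_cat /= !size_cat /= !addnS => -[->].
  case: s1 eP lastb szp => [|a' s1] [<- ep] /= lastb szp hs.
    by have := min (y :: s3) hs lastb; rewrite szp add0n /= ltnS leqNgt ltnS leq_addl.
  have := min (s1 ++ x :: y :: s3) hs lastb.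
  by rewrite szp !size_cat /= addSn !addnS !ltnS leqNgt ltnS addnA leq_add2r leq_addr.
move=> x y q xP yP hxy nexy uq.
have [s1 [s2 eP]] : exists s1 s2, a :: rcons p b = s1 ++ x :: s2.
  by case/splitPr: xP => s1 s2; exists s1, s2.
move: yP; rewrite eP mem_cat inE eq_sym (negPf nexy) /= => /orP[] /splitPr ys.
  move: eP; case: ys => s3 s4; rewrite -catA /= => eP.
  by right; apply: (consec _ _ _ _ _ _ eP) => //; rewrite hsym.
by move: eP; case: ys => s3 s4 eP; left; apply: (consec _ _ _ _ _ _ eP).
Qed.
End Induced.

(** * Cliques in the BFS layers *)

Section LayerClique.
Variables (n : nat) (e : rel 'I_n) (r : 'I_n).
Hypotheses (eP : simple_graph e) (econ : connected e) (echord : chordal e).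
Let esym : symmetric e := proj1 eP.
Let eirr : irreflexive e := proj2 eP.
Notation lev := (dist e r).

Lemma lower_connect i z : lev z < i -> connect (induced e [set z | lev z < i]) r z.
Proof.
elim: {z}(lev z) {-2}z (erefl (lev z)) => [|m IH] z lz lzi.
  by move/eqP: lz; rewrite dist_eq0 // => /eqP->.
have [x ezx lx] := dist_parent econ lz.
have lxi : lev x < i by rewrite lx; apply: ltn_trans lzi; rewrite lz.
apply: connect_trans (IH x lx lxi) (connect1 _).
by rewrite /induced /= !inE lxi lzi.
Qed.

(** Each path is shortest within its own side together with a and b, so a chord of the joined cycle
    would have to link the two interiors. These lie above and below layer i, and an edge changes the
    layer by at most one. *)
Lemma layer_clique i a b x y : lev a = i -> lev b = i -> a != b ->
  e a x -> e b y -> i < lev x -> i < lev y ->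
  connect (induced e [set z | i < lev z]) x y -> e a b.
Proof.
move=> la lb neab eax eby lx ly cxy; apply/negPn/negP => nab.
pose U := [set a; b] :|: [set z | i < lev z].
pose W := [set a; b] :|: [set z | lev z < i].
have cU : connect (induced e U) a b.
  apply: (connect_trans (y := x)); first by apply: connect1; rewrite /induced /= !inE eqxx lx eax orbT.
  apply: (connect_trans (y := y)); last first.
    by apply: connect1; rewrite /induced /= !inE eqxx ly !orbT esym eby.
  apply: connect_sub cxy => u w /and3P[]; rewrite !inE => uU wU euw.
  by apply: connect1; rewrite /induced /= !inE uU wU euw !orbT.
have cW : connect (induced e W) b a.
  have toW c : c \in [set a; b] -> connect (induced e W) r c.
    move=> cab; have lc : lev c = i by move: cab; rewrite !inE => /orP[]/eqP->.
    case: (posnP i) lc => [-> /eqP|i0 lc]; first by rewrite dist_eq0 // => /eqP->.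
    have [c' ecc' lc'] : exists2 x, e x c & lev x = i.-1.
      by apply: (dist_parent econ); rewrite lc prednK.
    have lt' : lev c' < i by rewrite lc' prednK.
    apply: (connect_trans (y := c')).
      apply: connect_sub (lower_connect lt') => u w /and3P[]; rewrite !inE => uU wU euw.
      by apply: connect1; rewrite /induced /= !inE uU wU euw !orbT.
    by apply: connect1; rewrite /induced /= 2![_ \in W]inE cab inE [c' \in _]inE lt' orbT.
  apply: connect_trans (toW a _); last by rewrite !inE eqxx.
  rewrite (sym_connect_sym (induced_sym _ esym)).
  by apply: toW; rewrite !inE eqxx orbT.
have [p [hp up cp]] := chordless_path (induced_sym U esym) cU neab.
have neba : b != a by rewrite eq_sym.
have [q [hq uq cq]] := chordless_path (induced_sym W esym) cW neba.
have ins (c d : 'I_n) (s : seq 'I_n) X : path (induced e X) c (rcons s d) ->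
    {subset c :: rcons s d <= X}.
  by move=> hs; apply: path_induced hs _; case: (s).
have inU z : z \in p -> i < lev z.
  move=> zp; have := ins _ _ _ _ hp z; rewrite inE mem_rcons inE zp !orbT => /(_ isT).
  rewrite !inE => /orP[/orP[]/eqP ez|//]; move: up; rewrite /= mem_rcons inE rcons_uniq -ez zp ?orbT //.
  by rewrite andbF.
have inW z : z \in q -> lev z < i.
  move=> zq; have := ins _ _ _ _ hq z; rewrite inE mem_rcons inE zq !orbT => /(_ isT).
  rewrite !inE => /orP[/orP[]/eqP ez|//]; move: uq; rewrite /= mem_rcons inE rcons_uniq -ez zq ?orbT //.
  by rewrite andbF.
have p0 : p != [::].
  by apply/eqP => p0; move: hp; rewrite p0 /= => /andP[/induced_sub eab _]; case/negP: nab.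
have q0 : q != [::].
  by apply/eqP => q0; move: hq; rewrite q0 /= => /andP[/induced_sub eba _]; case/negP: nab; rewrite esym.
pose c := a :: rcons p b ++ q.
have uc : uniq c.
  rewrite /c -cat_cons cat_uniq up /=; apply/andP; split.
    apply/hasPn => z /inW lz; rewrite inE mem_rcons inE.
    apply/negP => /or3P[/eqP ez|/eqP ez|/inU]; last by rewrite ltnNge ltnW.
      by rewrite ez la ltnn in lz.
    by rewrite ez lb ltnn in lz.
  by move: uq; rewrite /= rcons_uniq => /and3P[].
have cc : cycle e c.
  rewrite /c /= rcons_cat cat_path last_rcons; apply/andP; split.
    exact: sub_path (@induced_sub _ e U) _ _ hp.
  exact: sub_path (@induced_sub _ e W) _ _ hq.
have sc : 3 < size c.
  by rewrite /c /= size_cat size_rcons addSn !ltnS; case: (p) p0 => //= ? ?; case: (q) q0 => //= ? ?; rewrite addnS.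
(* Rotated to start at b, the cycle is the second path followed by a suffix, the shape to which [cq]
   applies. *)
have rotc : rot (size (a :: p)) c = b :: rcons q a ++ p.
  by rewrite /c -cats1 -catA -cat_cons rot_size_cat /= cat_rcons.
have [u [w [uc' wc euw nuw nwu]]] := echord uc sc cc.
have neuw : u != w by apply: contraTneq euw => ->; rewrite eirr.
have notU : ~ (u \in a :: rcons p b /\ w \in a :: rcons p b).
  case=> uU wU; have huw : induced e U u w.
    by rewrite /induced /= euw !(ins _ _ _ _ hp).
  by case: (cp u w q uU wU huw neuw uc) => /eqP; apply/negP.
have notW : ~ (u \in b :: rcons q a /\ w \in b :: rcons q a).
  case=> uU wU; have huw : induced e W u w.
    by rewrite /induced /= euw !(ins _ _ _ _ hq).
  have := cq u w p uU wU huw neuw; rewrite -rotc rot_uniq !next_rot //.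
  by case=> // /eqP; apply/negP.
have inc z : z \in c -> [\/ z \in [set a; b], z \in p | z \in q].
  rewrite /c !inE mem_cat mem_rcons inE.
  by case/or3P=> [->|/orP[->|->]|->]; rewrite ?orbT; [exact: Or31|exact: Or31|exact: Or32|exact: Or33].
have inU' z : z \in [set a; b] \/ z \in p -> z \in a :: rcons p b.
  by rewrite !inE mem_rcons inE; case=> [/orP[]->|->]; rewrite ?orbT.
have inW' z : z \in [set a; b] \/ z \in q -> z \in b :: rcons q a.
  by rewrite !inE mem_rcons inE; case=> [/orP[]->|->]; rewrite ?orbT.
have cross s t : e s t -> s \in p -> t \in q -> False.
  rewrite esym => ets /inU ls /inW lt; have := dist_step econ r ets.
  by rewrite leqNgt (leq_ltn_trans lt ls).
have ewu : e w u by rewrite esym.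
case: (inc u uc') => hu; case: (inc w wc) => hw;
  by [apply: notU; split; apply: inU'; auto | apply: notW; split; apply: inW'; auto
     | apply: (cross u w) | apply: (cross w u)].
Qed.

End LayerClique.

(** * Rerouting walks through layers, and balanced separators *)

Lemma connect_induced (T : finType) (h : rel T) X x y :
  connect (induced h X) x y -> x \in X -> y \in X.
Proof.
case/connectP=> [[_ ->//|z p]] hp -> _.
by apply: (path_induced hp) => //; apply: mem_last.
Qed.

Lemma connect_inv (T : finType) (h : rel T) (C : pred T) x y :
  (forall u w, h u w -> C u -> C w) -> connect h x y -> C x -> C y.
Proof.
move=> hC /connectP[p hp ->]; elim: p x hp => //= z p IH x /andP[hxz hp] Cx.
exact: IH hp (hC _ _ hxz Cx).
Qed.

Section Layers.
Variables (n : nat) (e : rel 'I_n) (r : 'I_n).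
Hypotheses (eP : simple_graph e) (econ : connected e) (echord : chordal e).
Let esym : symmetric e := proj1 eP.
Let eirr : irreflexive e := proj2 eP.
Notation lev := (dist e r).
Notation upto i := [set z | lev z <= i].
Notation above i := [set z | i < lev z].

Lemma ball_induced X k u : ball (induced e X) k u \subset ball e k u.
Proof.
elim: k => // k IH; apply/subsetP => y; rewrite in_ballS.
case/orP=> [yk|/existsP[x /andP[xk /induced_sub exy]]].
  by rewrite in_ballS (subsetP IH).
by apply: ball_step exy; apply: (subsetP IH).
Qed.

Lemma clique_up i y z x x' :
  lev y = i -> lev z = i -> e y x -> e z x' -> i < lev x ->
  connect (induced e (above i)) x x' -> y = z \/ e y z.
Proof.
move=> ly lz eyx ezx' lx cxx'; case: (eqVneq y z) => [|ne]; [by left|right].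
have lx' : x' \in above i by apply: (connect_induced cxx'); rewrite inE.
by apply: (layer_clique (i := i) eP econ echord _ _ _ _ _ _ _ cxx') => //; rewrite inE in lx'.
Qed.

(* An excursion of a walk above layer i leaves and reenters through two equal or
   adjacent vertices of layer i, hence costs at least as much as the shortcut. *)
Lemma ball_upto i k w x : lev w <= i -> x \in ball e k w ->
  if lev x <= i then is_true (x \in ball (induced e (upto i)) k w) else
  exists y m x', [/\ lev y = i, y \in ball (induced e (upto i)) m w, e y x' ,
    connect (induced e (above i)) x x' & (m < k) && e y x || (m.+1 < k)].
Proof.
move=> lw; elim: k x => [|k IH] x.
  by rewrite inE => /eqP->; rewrite lw.
rewrite in_ballS => /orP[xk|/existsP[x' /andP[x'k ex'x]]].
  have := IH _ xk; case: ifP => _; first by apply/subsetP/ball_le.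
  case=> [y [m [x' [? ? ? ? mk]]]]; exists y, m, x'; split=> //.
  case/orP: mk => [/andP[mk ->]|mk]; first by rewrite ltnS ltnW.
  by rewrite orbC ltnS ltnW.
have ls := dist_step econ r ex'x.
have ls' : lev x' <= (lev x).+1 by apply: dist_step; rewrite // esym.
have := IH _ x'k; case: (leqP (lev x') i) => lx'; case: (leqP (lev x) i) => lx.
- by move=> h; apply: ball_step h _; rewrite /induced /= !inE lx lx' ex'x.
- have lx'i : lev x' = i by apply/eqP; rewrite eqn_leq lx' -ltnS (leq_trans lx).
  by move=> h; exists x', k, x; rewrite ltnSn ex'x.
- have lxi : lev x = i by apply/eqP; rewrite eqn_leq lx -ltnS (leq_trans lx').
  case=> [y [m [x1 [ly yb eyx1 c1 mk]]]].
  have {}mk : m < k by case/orP: mk => [/andP[]|/ltnW].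
  have lx1 : x1 \in above i by apply: (connect_induced c1); rewrite inE.
  rewrite (sym_connect_sym (induced_sym _ esym)) in c1; rewrite inE in lx1.
  have [] := clique_up (z := x) ly lxi eyx1 _ lx1 c1; first by rewrite esym.
    by move=> <-; apply: (subsetP (ball_le _ _ _)) yb; rewrite ltnW // ltnS ltnW.
  move=> eyx; apply: (subsetP (ball_le _ _ (ltnW mk : m.+1 <= k.+1))).
  by apply: ball_step yb _; rewrite /induced /= !inE ly lxi leqnn.
- case=> [y [m [x1 [ly yb eyx1 c1 mk]]]].
  exists y, m, x1; split=> //; last first.
    by apply/orP; right; rewrite ltnS; case/orP: mk => [/andP[]|/ltnW].
  apply: connect_trans c1; apply: connect1.
  by rewrite /induced /= !inE lx lx' esym.
Qed.

(** If the excursion given by [ball_upto] is the single edge from y to v, then y is a parent.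
    Otherwise it has at least two edges, and the saved one pays for stepping from y to a parent p of
    v, equal or adjacent to y by [clique_up]. *)
Lemma ball_parent i v w m : lev v = i.+1 -> lev w <= i -> v \in ball e m w ->
  exists y m', [/\ e y v, lev y = i, m' < m & y \in ball (induced e (upto i)) m' w].
Proof.
move=> lv lw /(ball_upto lw); rewrite lv ltnn => -[y [m' [x [ly yb eyx cvx mk]]]].
case/orP: mk => [/andP[mk eyv]|mk]; first by exists y, m'.
have [p epv lp] := dist_parent econ lv.
have [] := clique_up lp ly epv eyx _ cvx; first by rewrite lv.
  by move=> ep; exists y, m'; rewrite (ltnW mk); split=> //; rewrite -ep.
move=> epy; exists p, m'.+1; split=> //; apply: ball_step yb _.
by rewrite /induced /= !inE ly lp leqnn esym.
Qed.

Lemma parent_lev i v y : lev v = i.+1 -> e y v -> lev y <= i -> lev y = i.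
Proof.
move=> lv eyv ly; apply/eqP; rewrite eqn_leq ly -ltnS -lv.
exact: dist_step.
Qed.

Lemma parents_adj i v y z : lev v = i.+1 -> e y v -> e z v ->
  lev y <= i -> lev z <= i -> y = z \/ e y z.
Proof.
move=> lv eyv ezv ly lz.
apply: (clique_up (parent_lev lv eyv ly) (parent_lev lv ezv lz) eyv ezv).
  by rewrite lv.
exact: connect0.
Qed.

(* The vertices of a shortest walk from v to t are closer to v than t, so they
   avoid N, hence S. *)
Lemma locate_component i v t (S N : {set 'I_n}) : lev v = i.+1 ->
  S \subset N -> N \subset upto i ->
  (forall s z, s \in S -> lev z <= i -> e s z -> z \in N) ->
  (forall z, z \in N -> ~~ e z v) ->
  t \in N -> (forall z, z \in N -> dist e t v <= dist e z v) ->
  t \notin S /\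
  forall y, e y v -> lev y <= i -> connect (induced e (upto i :\: S)) t y.
Proof.
move=> lv sSN sNi closed far tN tmin.
have lt : lev t <= i by have := subsetP sNi _ tN; rewrite inE.
have [y0 [m' [ey0v ly0 m't yb]]] : exists y m', [/\ e y v, lev y = i,
    m' < dist e t v & y \in ball (induced e (upto i)) m' t].
  by apply: ball_parent; rewrite // -dist_le.
have hsym := induced_sym (upto i) esym.
rewrite ball_sym // in yb.
have farN y : e y v -> y \notin N by move=> eyv; apply/negP => /far; rewrite eyv.
have notS z : z \notin N -> z \notin S by apply/contraNN/subsetP.
(* A vertex reached in k < m' steps from y0 is at distance at most k + 1 from v, hence closer than
   t, so the choice of t keeps it out of N. *)
have walk k z : z \in ball (induced e (upto i)) k y0 -> k < m' ->
    [/\ lev z <= i, z \notin N & connect (induced e (upto i :\: S)) y0 z].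
  elim: k z => [|k IH] z zk km.
    by move: zk; rewrite inE => /eqP->; rewrite ly0 farN // connect0.
  have zN : z \notin N.
    apply/negP => /tmin; rewrite leqNgt => /negP[]; apply: leq_ltn_trans m't.
    apply: leq_trans km; rewrite dist_le //.
    have zk' := subsetP (ball_induced _ _ _) _ zk.
    by rewrite ball_sym // in zk'; apply: ball_step zk' ey0v.
  move: (zk); rewrite in_ballS => /orP[/IH/(_ (ltnW km))//|/existsP[x /andP[xk]]].
  have [lx xN cx] := IH _ xk (ltnW km).
  case/and3P; rewrite !inE => _ lz exz; split=> //.
  apply: connect_trans cx (connect1 _).
  by rewrite /induced /= !inE lx lz exz !notS.
(* Only the last step of the walk reaches t. Its predecessor is outside N, while N contains the
   neighbours of S in layers up to i; so t is not in S. *)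
have [tS cy0t] : t \notin S /\ connect (induced e (upto i :\: S)) y0 t.
  case: m' m't yb walk => [|m] _; first by rewrite inE => /eqP et; have := farN _ ey0v; rewrite -et tN.
  rewrite in_ballS => tb walk; case/orP: tb => [/walk/(_ (ltnSn m))[]|]; first by rewrite tN.
  case/existsP=> x /andP[/walk/(_ (ltnSn m))[lx xN cx] /and3P[_ _ ext]].
  have tS : t \notin S by apply: contra xN => tS; apply: (closed _ _ tS); rewrite // esym.
  split=> //; apply: connect_trans cx (connect1 _).
  by rewrite /induced /= !inE lx lt ext tS notS.
split=> // y eyv ly; rewrite (sym_connect_sym (induced_sym _ esym)) in cy0t.
apply: connect_trans cy0t _.
have ly0' : lev y0 <= i by rewrite ly0.
case: (parents_adj lv ey0v eyv ly0' ly) => [->|ey0y]; first exact: connect0.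
by apply: connect1; rewrite /induced /= !inE ly ly0' ey0y !notS ?farN.
Qed.

(* S is the top layer of a smallest component of some [lev >= j] holding at least
   half of W. *)
Lemma separator D (W : {set 'I_n}) : max_degree_le e D -> W != set0 ->
  exists S : {set 'I_n}, [/\ S != set0, #|S| <= D.+1 * D.+1,
    exists2 w, w \in W & forall s, s \in S -> lev s <= lev w &
    forall t, t \notin S ->
      #|[set x in W | connect (induced e (~: S)) t x]|.*2 <= #|W|].
Proof.
move=> degD W0.
pose from j := [set z | j <= lev z].
pose comp j x := [set y | connect (induced e (from j)) x y].
pose Q m := [exists j : 'I_n.+1, exists x : 'I_n,
  [&& j <= lev x, #|comp j x| == m & #|W| <= #|W :&: comp j x|.*2]].
have exQ : exists m, Q m.
  exists #|comp 0 r|; apply/existsP; exists ord0; apply/existsP; exists r.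
  rewrite leq0n eqxx (_ : W :&: _ = W) -?addnn ?leq_addr //.
  apply/setIidPl/subsetP => y _; rewrite inE; apply: connect_sub (econ r y) => u w euw.
  by apply: connect1; rewrite /induced /= !inE.
case: (ex_minnP exQ) => m /existsP[j /existsP[x /and3P[jx /eqP cm Wc]]] minm.
have [lej Cin] : (forall y, y \in comp j x -> j <= lev y) /\
    forall y z, y \in comp j x -> e y z -> j <= lev z -> z \in comp j x.
  have lej y : y \in comp j x -> j <= lev y.
    by rewrite inE => /connect_induced; rewrite !inE => /(_ jx).
  split=> // y z yC eyz lz; have ly := lej _ yC; move: yC; rewrite !inE => cxy.
  by apply: connect_trans cxy (connect1 _); rewrite /induced /= !inE ly lz.
pose S := [set y in comp j x | lev y == j].
have [s0 s0S] : exists s, s \in S.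
  have xC : x \in comp j x by rewrite inE connect0.
  suff: forall k y, y \in comp j x -> lev y = (k + j)%N -> exists s, s \in S.
    by move/(_ (lev x - j)%N x xC); apply; rewrite subnK.
  elim=> [|k IH] y yC; first by rewrite add0n => ly; exists y; rewrite inE yC ly eqxx.
  rewrite addSn => ly; have [p epy lp] := dist_parent econ ly.
  by apply: (IH p) => //; apply: Cin yC _ _; rewrite 1?esym // lp leq_addl.
have [C0 SC] : 0 < #|S| /\ S \subset comp j x.
  by split; [rewrite card_gt0; apply/set0Pn; exists s0 | apply/subsetP => y; rewrite inE => /andP[]].
have lS s : s \in S -> lev s = j by rewrite inE => /andP[_ /eqP].
exists S; split.
- by rewrite -card_gt0.
(* S lies within distance 2 of a parent q of one of its vertices: S is connected above layer j - 1,
   so by [clique_up] the parents of its other vertices are equal or adjacent to q. For j = 0 only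
   the root is left. *)
- have [q qS] : exists q, S \subset ball e 2 q.
    case: (posnP j) => [j0|j0].
      exists r; apply/subsetP => y /lS/eqP; rewrite j0 dist_eq0 // => /eqP->.
      by apply: (subsetP (ball_le e r (leq0n 2))); rewrite inE.
    have parent y : y \in S -> exists2 q, e q y & lev q = j.-1.
      by move=> /lS ly; apply: (dist_parent econ); rewrite ly prednK.
    have [q eqs lq] := parent _ s0S.
    exists q; apply/subsetP => y yS; have [p epy lp] := parent _ yS.
    have jp z : (j.-1 < lev z) = (j <= lev z) by rewrite prednK.
    have cs0y : connect (induced e (above j.-1)) s0 y.
      apply: (connect_trans (y := x)); last first.
        move/(subsetP SC): yS; rewrite inE => /connect_sub; apply => u w /and3P[].
        by rewrite !inE => ju jw euw; apply: connect1; rewrite /induced /= !inE !jp ju jw.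
      rewrite (sym_connect_sym (induced_sym _ esym)).
      move/(subsetP SC): s0S; rewrite inE => /connect_sub; apply => u w /and3P[].
      by rewrite !inE => ju jw euw; apply: connect1; rewrite /induced /= !inE !jp ju jw.
    have qp : p \in ball e 1 q.
      have [] := clique_up lq lp eqs epy _ cs0y; first by rewrite jp lS.
        by move<-; rewrite in_ballS inE eqxx.
      by move=> eqp; apply: ball_step eqp; rewrite inE.
    exact: ball_step qp epy.
  exact: leq_trans (subset_leq_card qS) (card_ball2 _ degD).
- have /set0Pn[w] : W :&: comp j x != set0.
    by rewrite -card_gt0 -double_gt0 (leq_trans _ Wc) // card_gt0.
  by rewrite inE => /andP[wW /lej jw]; exists w => // s /lS ->.
move=> t tS; set X := [set _ in W | _].
have hX (P : pred 'I_n) : (forall u w, e u w -> w \notin S -> P u -> P w) -> P t ->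
    forall y, y \in X -> P y.
  move=> hP Pt y; rewrite inE => /andP[_ cty]; apply: (connect_inv _ cty Pt) => u w.
  by case/and3P=> _ wS euw; apply: hP euw _; rewrite inE in wS.
(* For t in the component, walks avoiding S stay in it strictly above layer j, inside a component of
   the layers from j + 1 on. That one misses S, hence is smaller, and by minimality holds less than
   half of W. *)
case: (boolP (t \in comp j x)) => tC.
  have tj : j < lev t by rewrite ltn_neqAle lej // andbT; move: tS; rewrite inE tC /= eq_sym.
  have jn : j.+1 < n.+1 by rewrite ltnS (leq_trans tj) // dist_leq_size.
  have sub : comp j.+1 t \subset comp j x :\: S.
    apply/subsetP => y; rewrite inE => cty.
    have : (y \in comp j x) && (j < lev y).
      apply: (@connect_inv _ _ (fun y => (y \in comp j x) && (j < lev y)) _ _ _ cty); last by rewrite tC.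
      move=> u w /and3P[_ lw euw] /andP[uC _]; rewrite inE in lw.
      by rewrite lw andbT; apply: Cin uC euw _; apply: ltnW.
    by case/andP=> yC ly; rewrite inE yC andbT inE yC /= gtn_eqF.
  have small : #|comp j.+1 t| < m.
    rewrite -cm; apply: leq_ltn_trans (subset_leq_card sub) _.
    by rewrite cardsD (setIidPr SC) ltn_subrL C0 (leq_trans C0) // subset_leq_card.
  have : ~~ Q #|comp j.+1 t| by apply/negP => /minm; rewrite leqNgt small.
  rewrite negb_exists => /forallP/(_ (Ordinal jn)); rewrite negb_exists => /forallP/(_ t).
  rewrite /= tj eqxx /= -ltnNge => /ltnW; apply: leq_trans; rewrite leq_double.
  apply/subset_leq_card/subsetP => y yX; rewrite inE; apply/andP; split.
    by move: yX; rewrite inE => /andP[].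
  rewrite inE; move: y yX; suff: forall y, y \in X -> [&& y \in comp j x, j < lev y &
      connect (induced e (from j.+1)) t y] by move=> h y /h/and3P[].
  apply: hX; last by rewrite tC tj connect0.
  move=> u w euw wS /and3P[uC ju ctu].
  have lw : j <= lev w.
    by rewrite -ltnS (leq_trans ju) //; apply: dist_step; rewrite // esym.
  have wC := Cin _ _ uC euw lw.
  have jw : j < lev w by rewrite ltn_neqAle lw andbT; move: wS; rewrite inE wC /= eq_sym.
  rewrite wC jw; apply: connect_trans ctu (connect1 _).
  by rewrite /induced /= !inE ju jw.
(* For t outside, an edge entering the component must end in S, so X is disjoint from the component,
   which holds at least half of W. *)
have : #|X| + #|W :&: comp j x| <= #|W|.
  rewrite -cardsUI (_ : X :&: _ = set0) ?cards0 ?addn0.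
    apply/subset_leq_card/subsetP => y; rewrite !inE.
    by case/orP=> /andP[].
  apply/setP => y; rewrite in_set0; apply/negbTE; rewrite inE; apply/negP => /andP[yX].
  rewrite inE => /andP[_]; apply/negP; move: y yX; apply: hX tC => u w euw wS; apply: contraNN => wC.
  have lw : j < lev w by rewrite ltn_neqAle lej // andbT; move: wS; rewrite inE wC /= eq_sym.
  apply: Cin wC _ _; rewrite 1?esym // -ltnS (leq_trans lw) //.
  by apply: dist_step.
move=> h; rewrite -addnn; apply: leq_trans (h); rewrite leq_add2l.
by rewrite -(leq_add2r #|W :&: comp j x|) (leq_trans h) // addnn.
Qed.

End Layers.

(** * Query strategies as refinements of a candidate set *)

Section Reach.
Variable n : nat.
Implicit Types (H : rel 'I_n -> Prop) (G : (rel 'I_n -> Prop) -> Prop).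

(* [H] is the set of graphs consistent with the answers so far; [reach q H G]
   says that some strategy asking at most [q] queries always ends in a set of
   candidates satisfying [G]. *)
Fixpoint reach (q : nat) H G : Prop :=
  G H \/
  match q with
  | 0 => False
  | q'.+1 => exists u v, forall a, reach q' (fun e => H e /\ dist e u v = a) G
  end.

Definition knows (T : Type) H (f : rel 'I_n -> T) :=
  forall e e', H e -> H e' -> f e = f e'.

Lemma reach0 q H G : G H -> reach q H G.
Proof. by case: q; left. Qed.

(** Sequential composition: the second phase may depend on the surviving candidates H', and facts
    about all of H persist on them. *)
Lemma reach_bind q1 q2 H G G' : reach q1 H G ->
  (forall H', (forall e, H' e -> H e) -> G H' -> reach q2 H' G') ->
  reach (q1 + q2) H G'.
Proof.
have mono d H1 q : reach q H1 G' -> reach (d + q) H1 G'.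
  elim: q d H1 => [|q IH] d H1 /= [].
  - exact: reach0.
  - by [].
  - exact: reach0.
  by move=> [u [v hu]]; rewrite addnS /=; right; exists u, v => a; apply: IH.
elim: q1 H => [|q1 IH] H /= [] //.
- by move=> GH h; apply: h GH.
- by move=> GH h; apply: (mono q1.+1); apply: h GH.
move=> [u [v hu]] h; right; exists u, v => a; apply: IH (hu a) _ => H' sub.
by apply: h => e /sub[].
Qed.

Lemma reach_leq q1 q2 H G : q1 <= q2 -> reach q1 H G -> reach q2 H G.
Proof.
by move=> /subnKC <- h; apply: reach_bind h _ => H' _; apply: reach0.
Qed.

Lemma reach_batch (s : seq ('I_n * 'I_n)) H :
  reach (size s) H
    (fun H' => forall p, p \in s -> knows H' (fun e => dist e p.1 p.2)).
Proof.
elim: s H => [|p s IH] H; first by apply: reach0.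
right; exists p.1, p.2 => a; rewrite -[size s]addn0.
apply: reach_bind (IH _) _ => H' sub hs; apply: reach0 => p'.
rewrite inE => /predU1P[-> e e' /sub[_ ->] /sub[_ ->] //|]; exact: hs.
Qed.

(** The query tree built here flips no coin, so its output is certain after at most q queries and
    one output step, whence [q.+1]. *)
Lemma reach_alg q H : reach q H (fun H' => knows H' (@edge_set n)) ->
  exists A : qalg n, forall e, H e ->
    pout (dist e) (edge_set e) q.+1 A = 1%R /\
    (forall k, (ecost (dist e) k A <= q%:R)%R).
Proof.
have known q' H' : knows H' (@edge_set n) -> exists A : qalg n, forall e, H' e ->
    pout (dist e) (edge_set e) q'.+1 A = 1%R /\
    (forall k, (ecost (dist e) k A <= q'%:R)%R).
  move=> kn; have [[e0 He0]|no] := classic (exists e, H' e).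
    exists (Out (edge_set e0)) => e He; split; first by rewrite /= (kn _ _ He He0) eqxx.
    by case=> [|k] /=; apply: ler0n.
  by exists (Out set0) => e He; case: no; exists e.
elim: q H => [|q IH] H /= [] //; [exact: (known 0)|exact: (known q.+1)|].
move=> [u [v huv]].
(* Distances are at most n, so finite choice over the answers in ['I_n.+1] suffices; [inord] sends
   the impossible larger answers to 0. *)
have /fin_all_exists[f hf] (a : 'I_n.+1) := IH _ (huv a).
exists (Ask u v (fun a => f (inord a))) => e He.
have ina : (inord (dist e u v) : 'I_n.+1) = dist e u v :> nat by rewrite inordK // ltnS dist_leq_size.
have [pf cf] := hf (inord (dist e u v)) e (conj He (esym ina)).
split=> [|[|k]] /=; [exact: pf | exact: ler0n|].
by rewrite -natr1 addrC lerD2r.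
Qed.

End Reach.

(** * Inserting the vertices one by one, with known layers [l] *)

Section Reconstruct.
Variables (n D : nat) (r : 'I_n).

Definition good (e : rel 'I_n) :=
  [/\ simple_graph e, connected e, chordal e & max_degree_le e D].

(** The known part of the graph: on X it can be read off any single candidate. *)
Definition agree (H : rel 'I_n -> Prop) (X : {set 'I_n}) :=
  forall e e' x y, H e -> H e' -> x \in X -> y \in X -> e x y = e' x y.

Variable l : 'I_n -> nat.

Notation admissible H := (forall e, H e -> good e /\ dist e r =1 l).
Notation upto i := [set z | l z <= i].


Lemma empty_or_inhab (H : rel 'I_n -> Prop) : (exists e, H e) \/ (forall e, ~ H e).
Proof.
by have [?|no] := classic (exists e, H e); [left | right=> e He; apply: no; exists e].
Qed.

(** Induction on m, the number of halvings of W left; a round asks at most (D+1)^3 queries, for a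
    separator and its neighbours. At m = 0 the set W would be empty, although every candidate gives
    v a parent in W. *)
Lemma reach_parent i v m H (W : {set 'I_n}) :
  l v = i.+1 -> admissible H -> agree H (upto i) -> W \subset upto i ->
  (forall e y, H e -> e y v -> l y <= i -> y \in W) -> #|W| < 2 ^ m ->
  reach (m * D.+1 ^ 3) H (fun H' => exists s, forall e, H' e -> l s <= i /\ e s v).
Proof.
move=> lv adm agr sWi; have triv k H' : (forall e, ~ H' e) ->
    reach k H' (fun H' => exists s, forall e, H' e -> l s <= i /\ e s v).
  by move=> no; apply: reach0; exists r => e He; case: (no e).
elim: m H W adm agr sWi => [|m IH] H W adm agr sWi parW ltW;
    have [[e0 He0]|] := empty_or_inhab H; try exact: triv;
    have [[eP econ echord edeg] e0l] := adm _ He0;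
    have [y0 e0y0v ly0] : exists2 x, e0 x v & dist e0 r x = i
      by apply: (dist_parent econ); rewrite e0l.
  move: ltW; rewrite expn0 ltnS leqn0 cards_eq0 => /eqP W0.
  by have := parW _ _ He0 e0y0v; rewrite -e0l ly0 leqnn W0 in_set0 => /(_ isT).
have W0 : W != set0.
  by apply/set0Pn; exists y0; apply: (parW e0); rewrite // -e0l ly0.
(* S separates one arbitrary candidate [e0]. Other candidates are compared with it only along walks
   in layers up to i, where all of them agree. *)
have [S [S0 cS [w wW lSw] half]] := separator r eP econ echord edeg W0.
have sSi : S \subset upto i.
  apply/subsetP => s /lSw; rewrite inE !e0l => /leq_trans; apply.
  by have := subsetP sWi _ wW; rewrite inE.
pose N := upto i :&: \bigcup_(s in S) ball e0 1 s.
have cN : #|N| <= D.+1 ^ 3.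
  apply: leq_trans (subset_leq_card (subsetIr _ _)) _.
  by apply: leq_trans (card_bigcup_ball1 _ edeg) _; rewrite !expnSr expn0 mul1n leq_mul2r cS orbT.
have sSN : S \subset N.
  rewrite subsetI sSi; apply/subsetP => s sS; apply/bigcupP; exists s => //.
  by apply: (subsetP (ball_le e0 s (leq0n 1))); rewrite inE.
have [t0 t0N] : exists t, t \in N by have /set0Pn[s /(subsetP sSN)] := S0; exists s.
rewrite mulSn; apply: (@reach_bind _ _ _ _ _ _ (reach_leq _ (reach_batch [seq (z, v) | z <- enum N] H))).
  by rewrite size_map -cardE.
move=> H' sub kn; have {}kn z e e' : z \in N -> H' e -> H' e' -> dist e z v = dist e' z v.
  by move=> zN; apply: (kn (z, v)); rewrite map_f // mem_enum.
have [[e1 He1]|] := empty_or_inhab H'; last exact: triv.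
have irr e : H' e -> irreflexive e by move=> /sub/adm[[[]]].
have con e : H' e -> connected e by move=> /sub/adm[[]].
(* Adjacency of z and v shows as answer 1, so it then holds in every remaining candidate. *)
have [/existsP[z /andP[zN e1zv]]|none] := boolP [exists z in N, e1 z v].
  apply: reach0; exists z => e He; split; first by move: zN; rewrite !inE => /andP[].
  rewrite -dist_eq1 ?(kn z e e1) ?dist_eq1 //; by [apply: con | apply: irr].
pose t := [arg min_(t < t0 in N) dist e1 t v].
have [tN tmin] : t \in N /\ forall z, z \in N -> dist e1 t v <= dist e1 z v.
  by rewrite /t; case: arg_minnP.
have loc e : H' e -> t \notin S /\
    forall y, e y v -> l y <= i -> connect (induced e0 (~: S)) t y.
  move=> He; have He' := sub _ He; have [[eP' econ' echord' edeg'] el] := adm _ He'.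
  have upE : [set z | dist e r z <= i] = upto i by apply/setP => z; rewrite !inE el.
  have [] := @locate_component _ e r eP' econ' echord' i v t S N.
  - by rewrite el.
  - by [].
  - by rewrite upE subsetIl.
  - move=> s z sS; rewrite el => lz esz; rewrite !inE lz; apply/bigcupP; exists s => //.
    have e0sz : e0 s z by rewrite (agr _ _ _ _ He0 He' (subsetP sSi _ sS)) // inE.
    by apply: ball_step e0sz; rewrite inE.
  - move=> z zN; rewrite -dist_eq1 ?(kn z e e1) ?dist_eq1 //; try exact: con; try exact: irr.
    by apply: contra none => e1zv; apply/existsP; exists z; rewrite zN.
  - by [].
  - by move=> z zN; rewrite !(kn _ e e1) //; apply: tmin.
  move=> tS cy; split=> // y eyv ly; have := cy y eyv; rewrite el => /(_ ly).
  apply: connect_sub => a b /and3P[]; rewrite upE !inE => /andP[aS la] /andP[bS lb] eab.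
  by apply: connect1; rewrite /induced /= !inE aS bS (agr _ _ _ _ He0 He') // inE.
have [tS _] := loc _ He1.
apply: (IH H' [set x in W | connect (induced e0 (~: S)) t x]).
- by move=> e /sub/adm.
- by move=> e e' x y /sub He /sub He'; apply: agr.
- by apply: subset_trans sWi; apply/subsetP => x; rewrite inE => /andP[].
- move=> e y He eyv ly; rewrite inE (parW e) //; last exact: sub.
  by have [_] := loc _ He; apply.
- by rewrite -ltn_double (leq_ltn_trans (half _ tS)) // -mul2n -expnS.
Qed.

(** Once a parent s is known, the neighbours of v in P are close to it: those in lower layers are
    parents, equal or adjacent to s, and one in the layer of v has a parent that is again equal or
    adjacent to s. Hence (D+1)^2 further queries suffice. *)
Lemma reach_vertex v m H (P : {set 'I_n}) : 0 < l v -> v \notin P ->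
  (forall z, l z < l v -> z \in P) -> (forall z, z \in P -> l z <= l v) ->
  n < 2 ^ m -> admissible H -> agree H P ->
  reach (m * D.+1 ^ 3 + D.+1 ^ 2) H (agree^~ (v |: P)).
Proof.
case lv: (l v) => [//|i] _ vP below top nm adm agr.
have agr_upto : agree H (upto i).
  by move=> e e' x y He He'; rewrite !inE => lx ly; apply: agr => //; apply: below; rewrite ltnS.
apply: (@reach_bind _ _ _ _ _ _ (@reach_parent i v m H (upto i) lv adm agr_upto (subxx _) _ _)).
- by move=> e y _ _; rewrite inE.
- by apply: leq_ltn_trans nm; rewrite -[leqRHS]card_ord max_card.
move=> H' sub [s hs].
have [[e0 He0]|no] := empty_or_inhab H'; last by apply: reach0 => e e' x y He; case: (no e).
pose B := ball (induced e0 P) 2 s.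
have cB : #|B| <= D.+1 ^ 2.
  apply: leq_trans (subset_leq_card (ball_induced _ _ _ _)) _; rewrite -mulnn.
  by apply: card_ball2; case: (adm _ (sub _ He0)) => -[].
apply: reach_leq cB _; rewrite -[#|B|]addn0 cardE -(size_map (fun z => (z, v))).
apply: reach_bind (reach_batch _ _) _ => H2 sub2 kn; apply: reach0.
have near e z : H2 e -> z \in P -> e z v -> z \in B.
  move=> /sub2 He zP ezv; have [[eP econ echord edeg] el] := adm _ (sub _ He).
  have esym : symmetric e := proj1 eP.
  have [ls esv] := hs _ He.
  have inP q : l q <= i -> q \in P by move=> lq; apply: below; rewrite ltnS.
  have adj x y : x \in P -> y \in P -> e x y -> induced e0 P x y.
    by move=> xP yP exy; rewrite /induced /= xP yP (agr e0 e) //; apply: sub.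
  have lv' : dist e r v = i.+1 by rewrite el.
  have ls' : dist e r s <= i by rewrite el.
  have one q : l q <= i -> s = q \/ e s q -> q \in ball (induced e0 P) 1 s.
    move=> lq [<-|esq]; first by apply: (subsetP (ball_le _ s (leq0n 1))); rewrite inE.
    by apply: ball_step (adj _ _ (inP _ ls) (inP _ lq) esq); rewrite inE.
  have := top _ zP; rewrite leq_eqVlt ltnS => /orP[/eqP lz|lz]; last first.
    apply: (subsetP (ball_le _ s (leqnSn 1))); apply: one (lz) _.
    by apply: (parents_adj eP econ echord lv') => //; rewrite el.
  have [q eqz lq] : exists2 q, e q z & dist e r q = i.
    by apply: (dist_parent econ); rewrite el.
  have lq' : l q <= i by rewrite -el lq.
  have sq : s = q \/ e s q.
    apply: (clique_up eP econ echord (parent_lev econ lv' esv ls') lq esv eqz).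
      by rewrite lv'.
    by apply: connect1; rewrite /induced /= !inE lv' el lz ltnSn esym.
  by apply: ball_step (one q lq' sq) (adj _ _ (inP _ lq') zP eqz).
have same e e' z : H2 e -> H2 e' -> z \in P -> e z v -> e' z v.
  move=> He He' zP ezv; have zB := near _ _ He zP ezv.
  have := kn (z, v) (map_f _ _) _ _ He He'; rewrite mem_enum => /(_ zB) /= eqd.
  have [[[_ eirr] econ _ _] _] := adm _ (sub _ (sub2 _ He)).
  have [[[_ eirr'] econ' _ _] _] := adm _ (sub _ (sub2 _ He')).
  by rewrite -dist_eq1 // -eqd dist_eq1.
move=> e e' x y He He'.
have [[[es eirr] _ _ _] _] := adm _ (sub _ (sub2 _ He)).
have [[[es' eirr'] _ _ _] _] := adm _ (sub _ (sub2 _ He')).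
have sameE z : z \in P -> e z v = e' z v.
  by move=> zP; apply/idP/idP; apply: same.
rewrite !inE => /predU1P[->|xP] /predU1P[->|yP]; first by rewrite eirr eirr'.
- by rewrite es es' sameE.
- exact: sameE.
- by apply: agr => //; apply/sub/sub2.
Qed.

(** Taking v of least layer outside P supplies the layer conditions of [reach_vertex] and keeps P
    closed under passing to smaller layers. *)
Lemma reach_all m H (P : {set 'I_n}) : r \in P ->
  (forall y z, y \in P -> l z < l y -> z \in P) ->
  n < 2 ^ m -> admissible H -> agree H P ->
  reach (#|~: P| * (m * D.+1 ^ 3 + D.+1 ^ 2)) H (agree^~ setT).
Proof.
move: {2}#|~: P| (erefl #|~: P|) => k; elim: k P H => [|k IH] P H cP rP down nm adm agr.
  move/eqP: (cP); rewrite cards_eq0 => /eqP cP0; apply: reach0.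
  by rewrite -[P]setCK cP0 setC0 in agr.
have [[e0 He0]|no] := empty_or_inhab H; last by apply: reach0 => e e' x y He; case: (no e).
have [[eP econ echord edeg] el] := adm _ He0.
have [v0 v0P] : exists v, v \in ~: P by apply/set0Pn; rewrite -card_gt0 cP.
have [v vP vmin] : exists2 v, v \in ~: P & forall z, z \in ~: P -> l v <= l z.
  by case: (arg_minnP l v0P) => v; exists v.
rewrite inE in vP.
have below z : l z < l v -> z \in P.
  by move=> lz; apply: contraLR lz => zP; rewrite -leqNgt vmin // inE.
have lv0 : 0 < l v.
  by rewrite lt0n -el dist_eq0 //; apply: contraNneq vP => ->.
have top z : z \in P -> l z <= l v.
  by move=> zP; rewrite leqNgt; apply: contra vP; apply: down.
have cP' : #|~: (v |: P)| = k.
  have := cardsC P; rewrite cP => h; have := cardsC (v |: P); rewrite cardsU1 vP add1n -h.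
  by rewrite addSn -addnS => /addnI[].
rewrite cP mulSn -cP'.
apply: reach_bind (reach_vertex lv0 vP below top nm adm agr) _ => H' sub agr'.
apply: IH => //.
- by rewrite !inE rP orbT.
- move=> y z; rewrite !inE => /predU1P[->|yP] lz; apply/orP; right; first exact: below.
  exact: down lz.
- by move=> e /sub/adm.
Qed.

End Reconstruct.

(** * Assembling the strategy and counting its queries *)

Lemma reach_good n D m (r : 'I_n) : n < 2 ^ m ->
  reach (n + n * (m * D.+1 ^ 3 + D.+1 ^ 2)) (good D) (fun H => knows H (@edge_set n)).
Proof.
move=> nm; pose s := [seq (r, z) | z <- enum 'I_n].
have szs : size s <= n by rewrite size_map size_enum_ord.
(* The first n queries fix all layers; insertion then starts from the root alone. *)
apply: (reach_bind (reach_leq szs (reach_batch s _))) => H sub kn.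
have [[e0 He0]|no] := empty_or_inhab H; last by apply: reach0 => e e' He; case: (no e).
have adm e : H e -> good D e /\ dist e r =1 dist e0 r.
  move=> He; split; first exact: sub.
  by move=> z; apply: (kn (r, z)); rewrite // map_f // mem_enum.
have [eP econ _ _] := sub _ He0.
rewrite -[(n * _)%N]addn0.
apply: (@reach_bind _ _ _ _ (fun H => agree H setT)).
  apply: (@reach_leq _ (#|~: [set r]| * (m * D.+1 ^ 3 + D.+1 ^ 2))).
    by rewrite leq_mul2r -[X in _ <= X]card_ord max_card orbT.
  apply: reach_all adm _ => //; first by rewrite inE.
    move=> y z; rewrite inE => /eqP->; have /eqP -> : dist e0 r r == 0 by rewrite dist_eq0.
    by [].
  move=> e e' x y /sub[[_ eirr] _ _ _] /sub[[_ eirr'] _ _ _].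
  by rewrite !inE => /eqP-> /eqP->; rewrite eirr eirr'.
move=> H' sub' agr; apply: reach0 => e e' He He'.
by apply/setP => -[x y]; rewrite !inE; apply: agr; rewrite ?inE.
Qed.

(** The constant is 21 = 1 + 16 + 4, from g + 1 <= 2g, (D+1)^3 <= 8D^3 and (D+1)^2 <= 4D^2; the
    remaining factors on the right are at least 1. *)
Lemma query_bound D n g : 0 < D -> 0 < g ->
  n + n * (g.+1 * D.+1 ^ 3 + D.+1 ^ 2) <=
    21 * D ^ 3 * 2 ^ D * n * (2 ^ D + g ^ 2) * g.
Proof.
move=> D0 g0.
have D3 : (D.+1 ^ 3 <= 8 * D ^ 3).
  by rewrite -[8]/(2 ^ 3) -expnMn leq_exp2r // mul2n -addnn -addn1 leq_add2l.
have D2 : (D.+1 ^ 2 <= 4 * (D ^ 3 * g)).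
  apply: (@leq_trans (4 * D ^ 2)).
    by rewrite -[4]/(2 ^ 2) -expnMn leq_exp2r // mul2n -addnn -addn1 leq_add2l.
  rewrite leq_mul2l /= -[X in (X <= _)]muln1 leq_mul //.
  by rewrite leq_pexp2l.
have main : (n + n * (g.+1 * D.+1 ^ 3 + D.+1 ^ 2) <= 21 * (D ^ 3 * g) * n).
  rewrite -[X in (X + _)]muln1 -mulnDr [X in (_ <= X)]mulnC leq_mul2l; apply/orP; right.
  have h1 : (1 <= D ^ 3 * g) by rewrite muln_gt0 expn_gt0 D0.
  have h2 : (g.+1 * D.+1 ^ 3 <= 16 * (D ^ 3 * g)).
    rewrite (_ : (16 * _ = (2 * g) * (8 * D ^ 3))); last by rewrite mulnACA [(g * _)]mulnC.
    by apply: leq_mul => //; rewrite mul2n -addnn -addn1 leq_add2l.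
  apply: leq_trans (leq_add h1 (leq_add h2 D2)) _.
  by rewrite -mulnDl -mulSn.
apply: leq_trans main _.
rewrite (_ : (21 * (D ^ 3 * g) * n = 21 * D ^ 3 * 1 * n * 1 * g)); last first.
  by rewrite !muln1 -!mulnA [g * n]mulnC.
rewrite !leq_mul // ?expn_gt0 //.
by rewrite (leq_trans _ (leq_addr _ _)) // expn_gt0.
Qed.

Local Open Scope ring_scope.

Theorem theorem3 :
  exists C : nat, forall (D n : nat), (2 <= n)%N ->
    exists A : qalg n,
      forall e : rel 'I_n,
        simple_graph e -> connected e -> chordal e -> max_degree_le e D ->
        outputs_as (dist e) (edge_set e) A /\
        expected_queries_le (dist e) A
          ((C * D ^ 3 * 2 ^ D * n * (2 ^ D + log2c n ^ 2) * log2c n)%N%:R).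
Proof.
exists 21%N => D n n2; set g := log2c n.
(* [up_log] gives only n <= 2^g, while the halving needs a strict bound; hence the exponent g +
   1. *)
have ng : (n < 2 ^ g.+1)%N.
  by rewrite (leq_ltn_trans (up_logP n (isT : (1 < 2)%N))) // ltn_exp2l.
pose r : 'I_n := Ordinal (ltnW n2).
have [A hA] := reach_alg (reach_good D r ng).
exists A => e eP econ echord edeg.
have [pA cA] := hA e (And4 eP econ echord edeg).
split=> [eps eps0|k].
  by exists (n + n * (g.+1 * D.+1 ^ 3 + D.+1 ^ 2)).+1%N; rewrite pA lerBlDr lerDl ltW.
apply: le_trans (cA k) _; rewrite ler_nat.
have g0 : (0 < g)%N by rewrite /g /log2c up_log_gt0.
(* Vertex 1 differs from the root, so its predecessor on a shortest path from the root has positive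
   degree. *)
have D0 : (0 < D)%N.
  pose s : 'I_n := Ordinal n2.
  have : (0 < dist e r s)%N by rewrite lt0n dist_eq0.
  case ds: (dist e r s) => [//|m] _; have [x exs _] := dist_parent econ ds.
  apply: leq_trans (edeg x); rewrite card_gt0; apply/set0Pn; exists s.
  by rewrite inE.
exact: query_bound.
Qed.
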